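(* For $\lambda>0$ let $N_\lambda$ be a Poisson random variable with parameter $\lambda$. Then $$\inf_{\lambda>0}P\left\{|N_\lambda-E[N_\lambda]|\le\sqrt{\mathrm{Var}(N_\lambda)}\right\}=1.5e^{-1}.$$ *)

(* Defs.v *)
From HB Require Import structures.
From mathcomp Require Import all_boot all_order all_algebra.
From mathcomp Require Import all_classical all_reals all_analysis.
Set Implicit Arguments. Unset Strict Implicit. Unset Printing Implicit Defensive.
Import Order.TTheory GRing.Theory Num.Theory.
Local Open Scope ring_scope.

(* The law of a Poisson random variable with parameter [lam], realised on its
   canonical sample space [nat] (library [poisson_prob]; its second argument
   only matters when [lam <= 0], which is excluded below). *)
Definition poissonP (R : realType) (lam : R) : probability nat R :=
  poisson_prob lam 0.

Definition poissonN (R : realType) : nat -> R := fun n => n%:R.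

(* Main.v *)
Require Import Defs.
From HB Require Import structures.
From mathcomp Require Import all_boot all_order all_algebra.
From mathcomp Require Import ring lra zify.
From mathcomp Require Import all_classical all_reals all_analysis.
Set Implicit Arguments. Unset Strict Implicit. Unset Printing Implicit Defensive.
Import Order.TTheory GRing.Theory Num.Theory.
Import numFieldNormedType.Exports.
Local Open Scope classical_set_scope.
Local Open Scope ring_scope.

(* Let [s = sqrt lam]. As [lam] decreases to [1] the window
   [lam - s, lam + s] contains only the integers 1 and 2, which gives the
   limiting value [(1 + 1/2) / e]; it remains to bound the probability of the
   window from below for every [lam].
   - For [lam] up to 16/3 the window contains an explicit integer interval
     [m, n], and [P(m <= N <= n)] is unimodal in [lam] (its derivative is
     [P(N = m - 1) - P(N = n)]), so it suffices to evaluate it at the end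
     points of finitely many intervals of [lam].
   - For larger [lam] the two tails are bounded separately. The tail
     [P(N >= n)] increases with [lam], so the worst case is [lam + s = n], and
     likewise [lam - s = m] for [P(N <= m)]. There Stirling's formula bounds
     the boundary atom, and a convergent of the continued fraction of the
     incomplete gamma function bounds the ratio of the tail to that atom (a
     geometric series would be too weak). The two tails sum to at most
     [56 / 125 < 1 - 3 / (2 e)]. *)

(** * Poisson weights and distribution function, as functions of the parameter *)

Section Poisson.
Variable R : realType.
Implicit Types (x a b : R) (k m n : nat).

Definition ppmf x k : R := x ^+ k * k`!%:R^-1 * expR (- x).

(** Leaving out [n] makes [pcdf n x - pcdf m x] the mass of the half-open range [m <= k < n],
    including [m = 0]. *)
Definition pcdf n x : R := \sum_(k < n) ppmf x k.

Lemma ppmf_ge0 x k : 0 <= x -> 0 <= ppmf x k.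
Proof. by move=> x0; rewrite /ppmf !mulr_ge0 ?exprn_ge0 ?invr_ge0 ?expR_ge0. Qed.

Lemma factS_neq0 k : (k.+1)%:R != 0 :> R.
Proof. by rewrite pnatr_eq0. Qed.

Lemma ppmfS x k : ppmf x k.+1 = x / k.+1%:R * ppmf x k.
Proof.
rewrite /ppmf factS natrM exprS invfM; ring.
Qed.

Lemma pcdfS n x : pcdf n.+1 x = pcdf n x + ppmf x n.
Proof. by rewrite /pcdf big_ord_recr. Qed.

Lemma pcdf0 x : pcdf 0 x = 0.
Proof. by rewrite /pcdf big_ord0. Qed.

Lemma is_derive_expRN x : is_derive x 1 (fun y : R => expR (- y)) (- expR (- x)).
Proof.
have := @is_derive1_comp _ expR -%R x (expR (- x)) (-1) (is_derive_expR _) _.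
rewrite mulrN1; by apply.
Qed.

Lemma is_derive_ppmf0 x : is_derive x 1 (ppmf ^~ 0%N) (- ppmf x 0).
Proof.
have -> : ppmf ^~ 0%N = fun y => expR (- y).
  by apply/funext => y; rewrite /ppmf expr0 fact0 invr1 !mul1r.
rewrite /ppmf expr0 fact0 invr1 !mul1r; exact: is_derive_expRN.
Qed.

Lemma is_derive_ppmfS x k :
  is_derive x 1 (ppmf ^~ k.+1) (ppmf x k - ppmf x k.+1).
Proof.
have DX : is_derive x 1 (fun y : R => y ^+ k.+1) (k.+1%:R * x ^+ k).
  have := @is_deriveX _ _ (@id R) k.+1 x 1 1 (is_derive_id _ _).
  rewrite /= /GRing.scale /= mulr1.
  by rewrite (_ : id ^+ k.+1 = fun y : R => y ^+ k.+1)//;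
     apply/funext => y; rewrite fctE.
have := @is_deriveZ _ _ _ _ k.+1`!%:R^-1 x 1 _
  (@is_deriveM _ _ _ _ x 1 _ _ DX (is_derive_expRN x)).
rewrite (_ : _ \*: _ = ppmf ^~ k.+1); last first.
  apply/funext => y; rewrite /ppmf /= /GRing.scale/= !fctE.
  by rewrite mulrA (mulrC _^-1).
move=> D; apply: is_derive_eq.
rewrite /ppmf /GRing.scale/= factS natrM exprS.
have := factS_neq0 k; have : k`!%:R != 0 :> R by rewrite pnatr_eq0 -lt0n fact_gt0.
by move=> h1 h2; field; rewrite nat1r h1 h2.
Qed.

(** The derivatives [ppmf x k - ppmf x k.+1] of the single weights telescope. *)
Lemma is_derive_pcdf n x : is_derive x 1 (pcdf n.+1) (- ppmf x n).
Proof.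
elim: n => [|n IH].
  have -> : pcdf 1 = ppmf ^~ 0%N by apply/funext => y; rewrite pcdfS pcdf0 add0r.
  exact: is_derive_ppmf0.
have -> : pcdf n.+2 = pcdf n.+1 + ppmf ^~ n.+1 by apply/funext => y; rewrite pcdfS.
have := is_derive_ppmfS x n => D.
apply: is_derive_eq.
by rewrite addrA addNr add0r.
Qed.

Lemma is_derive_ndecr (f df : R -> R) a b : a <= b ->
  (forall x, a <= x <= b -> is_derive x 1 f (df x)) ->
  (forall x, a <= x <= b -> 0 <= df x) -> f a <= f b.
Proof.
move=> ab fD df0.
have [x||c] := @MVT_segment R f df a b ab.
- by rewrite in_itv/= => /andP[ax xb]; apply: fD; rewrite !ltW.
- apply: derivable_within_continuous => x; rewrite in_itv/= => /fD D.
  exact: ex_derive.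
rewrite in_itv/= => /df0 c0 E; rewrite -subr_ge0 E mulr_ge0// subr_ge0 //.
Qed.

Lemma pcdf_nincr n a b : a <= b -> 0 <= a -> pcdf n b <= pcdf n a.
Proof.
case: n => [|n] ab a0; first by rewrite !pcdf0.
rewrite -lerN2; apply: (@is_derive_ndecr (- pcdf n.+1) (ppmf ^~ n)) => //
  x /andP[ax xb].
  by have := @is_derive_pcdf n x => D; apply: is_derive_eq; rewrite opprK.
by apply: ppmf_ge0; exact: le_trans ax.
Qed.

(** The derivative in the parameter changes sign at most once, from plus to minus. By its sign at
    [x], the mass either increases on [[a, x]] or decreases on [[x, b]]. *)
Lemma pcdf_window_min m n a b x : (m <= n)%N -> 0 < a -> a <= x <= b ->
  pcdf n.+1 a - pcdf m.+1 a <= pcdf n.+1 x - pcdf m.+1 x \/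
  pcdf n.+1 b - pcdf m.+1 b <= pcdf n.+1 x - pcdf m.+1 x.
Proof.
move=> mn a0 /andP[ax xb].
have D (y : R) : is_derive y 1 (pcdf n.+1 - pcdf m.+1) (ppmf y m - ppmf y n).
  have D1 := @is_derive_pcdf n y; have D2 := @is_derive_pcdf m y.
  by apply: is_derive_eq; rewrite opprK addrC.
have x0 : 0 < x by apply: lt_le_trans ax.
(* The last factor carries the sign and is nonincreasing in [y >= 0]. *)
have E y : ppmf y m - ppmf y n =
    ppmf y m * m`!%:R * (m`!%:R^-1 - y ^+ (n - m) * n`!%:R^-1).
  have h : m`!%:R != 0 :> R by rewrite pnatr_eq0 -lt0n fact_gt0.
  have h' : n`!%:R != 0 :> R by rewrite pnatr_eq0 -lt0n fact_gt0.
  rewrite /ppmf -[in y ^+ n](subnK mn) exprD; field; rewrite h h'//.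
have [le|lt] := leP (x ^+ (n - m) * n`!%:R^-1) (m`!%:R^-1).
  left; apply: (@is_derive_ndecr (pcdf n.+1 - pcdf m.+1)
    (fun y => ppmf y m - ppmf y n) _ _ ax) => y /andP[ay yx].
  have y0 : 0 <= y by rewrite (le_trans (ltW a0)).
  rewrite E mulr_ge0//; first by rewrite mulr_ge0 ?ppmf_ge0.
  rewrite subr_ge0 (le_trans _ le)//.
  by rewrite ler_wpM2r ?invr_ge0// lerXn2r ?nnegrE// (ltW x0).
right; rewrite -lerN2.
apply: (@is_derive_ndecr (- (pcdf n.+1 - pcdf m.+1))
  (fun y => - (ppmf y m - ppmf y n)) _ _ xb) => y /andP[xy yb].
have y0 : 0 <= y by rewrite (le_trans (ltW x0)).
rewrite E -mulrN mulr_ge0//; first by rewrite mulr_ge0 ?ppmf_ge0.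
rewrite oppr_ge0 subr_le0 (le_trans (ltW lt))//.
by rewrite ler_wpM2r ?invr_ge0// lerXn2r ?nnegrE// (ltW x0).
Qed.

Lemma cvg_pcdf x : pcdf n x @[n --> \oo] --> (1 : R).
Proof.
have -> : (1 : R) = expR x * expR (- x) by rewrite expRxMexpNx_1.
have -> : (fun n => pcdf n x) = (fun n => series (exp_coeff x) n * expR (- x)).
  apply/funext => n; rewrite /pcdf /series/= big_mkord mulr_suml.
  by apply: eq_bigr => i _.
apply: cvgMr_tmp; rewrite /expR; exact: is_cvg_series_exp_coeff.
Qed.

Lemma pcdf_le1 n x : 0 <= x -> pcdf n x <= 1.
Proof.
move=> x0; rewrite -(cvg_lim _ (cvg_pcdf x))//.
apply: (@nondecreasing_cvgn_le R (fun n => pcdf n x)) => //.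
- apply/nondecreasing_seqP => k; rewrite pcdfS lerDl ppmf_ge0//.
- by apply/cvg_ex; exists 1; exact: cvg_pcdf.
Qed.

End Poisson.

(** * Mean and variance of the Poisson law *)

Section Moments.
Variable R : realType.
Implicit Types (x a b : R) (k m n : nat).

Lemma poissonP_set1 x k : 0 < x -> poissonP x [set k] = (ppmf x k)%:E.
Proof.
move=> x0; rewrite /poissonP /= /poisson_prob x0 esum_set1 ?lee_fin ?poisson_pmf_ge0//.
by rewrite /poisson_pmf x0.
Qed.

Lemma poissonP_window x m n : 0 < x -> (m <= n)%N ->
  poissonP x [set k | (m <= k < n)%N] = (pcdf n x - pcdf m x)%:E.
Proof.
move=> x0; elim: n => [|n IH] mn.
  move: mn; rewrite leqn0 => /eqP ->.
  rewrite subrr (_ : [set k | _] = set0) ?measure0//.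
  by apply/seteqP; split => k //=; rewrite ltn0 andbF.
have [->|mn'] := eqVneq m n.+1.
  rewrite subrr (_ : [set k | _] = set0) ?measure0//.
  by apply/seteqP; split => k //=; lia.
have {}mn : (m <= n)%N by rewrite -ltnS ltn_neqAle mn' mn.
rewrite (_ : [set k | _] = [set k | (m <= k < n)%N] `|` [set n]); last first.
  apply/seteqP; split => k /=.
    by rewrite ltnS => /andP[mk]; rewrite leq_eqVlt => /orP[/eqP ->|kn];
      [right|left; rewrite mk].
  by case => [/andP[-> kn]|->]; [exact: (leq_trans kn)|rewrite mn ltnSn].
rewrite measureU//; last first.
  by apply/seteqP; split => k //= -[/andP[_ kn] kE]; rewrite kE ltnn in kn.
rewrite [in RHS]pcdfS addrAC EFinD; congr (_ + _)%E; first exact: IH.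
exact: poissonP_set1.
Qed.

Lemma poissonP_ge x m n (A : set nat) : 0 < x -> (m <= n)%N ->
  (forall k, (m <= k < n)%N -> A k) -> pcdf n x - pcdf m x <= fine (poissonP x A).
Proof.
move=> x0 mn sub; rewrite -lee_fin fineK ?fin_num_measure// -poissonP_window//.
by apply: le_measure; rewrite ?inE.
Qed.

(** Cutting [nat] into singletons turns the integral into a series, so that moments become limits of
    real partial sums. *)
Lemma poisson_integral x (f : nat -> R) (l : R) : 0 < x -> (forall k, 0 <= f k) ->
  \sum_(k < n) f k * ppmf x k @[n --> \oo] --> l ->
  (\int[poissonP x]_k (f k)%:E = l%:E)%E.
Proof.
move=> x0 f0 fl.
have -> : [set: nat] = \bigcup_k [set k] by apply/seteqP; split => k // _; exists k.
rewrite ge0_integral_bigcup//; last 2 first.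
  by move=> k _; rewrite lee_fin.
  by move=> i j _ _ [k [-> ->]].
rewrite (_ : (fun n => _) = EFin \o (fun n => \sum_(k < n) f k * ppmf x k)).
  rewrite EFin_lim; last by apply/cvg_ex; exists l.
  by rewrite (cvg_lim _ fl).
apply/funext => n /=; rewrite big_mkord -sumEFin; apply: eq_bigr => k _.
rewrite (eq_integral (cst (f k)%:E)); last by move=> i; rewrite inE => ->.
by rewrite integral_cst// EFinM; congr (_ * _)%E; exact: poissonP_set1.
Qed.

(** Multiplying by [k] shifts the weights: [k%:R * ppmf x k = x * ppmf x (k - 1)] for [k > 0]. The
    factor [k (k - 1)] below shifts them twice. *)
Lemma sum_mean x n : \sum_(k < n.+1) k%:R * ppmf x k = x * pcdf n x.
Proof.
elim: n => [|n IH]; first by rewrite big_ord1 mul0r pcdf0 mulr0.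
rewrite big_ord_recr/= IH pcdfS mulrDr ppmfS; congr (_ + _).
by rewrite mulrA [n.+1%:R * _]mulrC divfK// factS_neq0.
Qed.

Lemma sum_fact2 x n : \sum_(k < n.+2) k%:R * (k%:R - 1) * ppmf x k = x ^+ 2 * pcdf n x.
Proof.
elim: n => [|n IH].
  by rewrite big_ord_recr big_ord1/= subrr pcdf0 !(mul0r, mulr0) addr0.
rewrite big_ord_recr/= IH pcdfS [in RHS]mulrDr !ppmfS; congr (_ + _).
rewrite -(natr1 n.+1) addrK.
have := factS_neq0 R n; have := factS_neq0 R n.+1.
by rewrite -!(nat1r n.+1) -!(nat1r n) (addrC 1 (1 + _)) => h1 h2; field; rewrite h1 h2.
Qed.

Lemma poisson_expectation x : 0 < x -> ('E_(poissonP x)[@poissonN R] = x%:E)%E.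
Proof.
move=> x0; rewrite unlock; apply: poisson_integral => //.
rewrite -(cvg_shiftS (fun n => \sum_(k < n) _)) /=.
under eq_fun do rewrite sum_mean.
have : x * pcdf n x @[n --> \oo] --> x * 1.
  by apply: cvgM; [exact: cvg_cst|exact: cvg_pcdf].
by rewrite mulr1.
Qed.

Lemma poisson_variance x : 0 < x -> ('V_(poissonP x)[@poissonN R] = x%:E)%E.
Proof.
move=> x0; rewrite /variance unlock poisson_expectation//= unlock.
apply: (@poisson_integral x (fun k => (k%:R - x) * (k%:R - x))) => // [k|].
  by rewrite -expr2 sqr_ge0.
rewrite -(cvg_shiftn 2 (fun n => \sum_(k < n) _)) /=.
(* Expand [(k - x)^2 = k (k - 1) + (1 - 2 x) k + x^2]; the shift by 2 gives the three sums a common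
   range. *)
have E n : \sum_(k < n + 2) (k%:R - x) * (k%:R - x) * ppmf x k =
    x ^+ 2 * pcdf n x + (1 - x *+ 2) * (x * pcdf n.+1 x) + x ^+ 2 * pcdf n.+2 x.
  rewrite addn2 -sum_fact2 -sum_mean /pcdf !mulr_sumr -!big_split/=.
  by apply: eq_bigr => k _; ring.
under eq_fun do rewrite E.
have c0 := @cvg_pcdf R x.
have c1 : pcdf n.+1 x @[n --> \oo] --> (1 : R)
  by rewrite (cvg_shiftS (fun n => pcdf n x)).
have c2 : pcdf n.+2 x @[n --> \oo] --> (1 : R)
  by rewrite (cvg_shiftS (fun n => pcdf n.+1 x)).
have : x ^+ 2 * pcdf n x + (1 - x *+ 2) * (x * pcdf n.+1 x) + x ^+ 2 * pcdf n.+2 x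
    @[n --> \oo] --> x ^+ 2 * 1 + (1 - x *+ 2) * (x * 1) + x ^+ 2 * 1.
  apply: cvgD; first apply: cvgD; apply: cvgM; try exact: cvg_cst; try exact: c0.
    by apply: cvgM; [exact: cvg_cst|exact: c1].
  exact: c2.
by rewrite (_ : _ + x ^+ 2 * 1 = x)//; ring.
Qed.

End Moments.

(** * Continued-fraction bounds for the two tails *)

Section Tails.
Variable R : realType.
Implicit Types (x y : R) (k m n : nat).

(* Third convergents of the continued fractions of the lower and upper
   incomplete gamma functions, which dominate the ratios
   [P(N >= n) / P(N = n)] for [x < n] and [P(N <= m) / P(N = m)] for [m < x]. *)
Definition upper_ratio x n : R :=
  let y := n%:R - x in let N := (y + 1) * (y + 2) + 2 * x in
  n%:R * N / (y * N + x * (y + 2)).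

Definition lower_ratio x m : R :=
  let y := x - m%:R in let N := (y + 2) * (y + 4) + 2 * m%:R - 2 in
  x * N / (y * N + m%:R * (y + 4)).

Lemma upper_ratio_ge0 x n : 0 < x -> x < n%:R -> 0 <= upper_ratio x n.
Proof.
move=> x0 xn; rewrite /upper_ratio; set y := n%:R - x.
have y0 : 0 < y by rewrite subr_gt0.
set N := (y + 1) * (y + 2) + 2 * x; have N0 : 0 < N by rewrite /N; nra.
by rewrite /= divr_ge0 ?mulr_ge0 ?ler0n ?ltW//; nra.
Qed.

(** The exact ratio [P(N >= n) / P(N = n)] satisfies this recursion with equality. For the
    convergent, the excess is [6 x^3 / (D E)]. *)
Lemma upper_ratio_step x n : 0 < x -> x < n%:R ->
  1 + x / n.+1%:R * upper_ratio x n.+1 <= upper_ratio x n.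
Proof.
move=> x0 xn; rewrite /upper_ratio /= -[n.+1%:R]natr1.
have [y y0 ->] : exists2 y, 0 < y & n%:R = x + y.
  by exists (n%:R - x); [rewrite subr_gt0|ring].
have -> : x + y - x = y by ring.
have -> : x + y + 1 - x = y + 1 by ring.
set N := (y + 1) * (y + 2) + 2 * x.
set M := (y + 1 + 1) * (y + 1 + 2) + 2 * x.
have N0 : 0 < N by rewrite /N; nra.
have M0 : 0 < M by rewrite /M; nra.
set D := y * N + x * (y + 2).
set E := (y + 1) * M + x * (y + 1 + 2).
have D0 : 0 < D by rewrite /D; nra.
have E0 : 0 < E by rewrite /E; nra.
have xy : 0 < x + y + 1 by lra.
rewrite -subr_ge0.
have -> : (x + y) * N / D - (1 + x / (x + y + 1) * ((x + y + 1) * M / E)) =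
    6 * x ^+ 3 / (D * E).
  rewrite [RHS](_ : _ = ((x + y) * N * E - D * E - x * M * D) / (D * E)).
    by field; rewrite !gt_eqF.
  by congr (_ / _); rewrite /D /E /M /N; ring.
by rewrite divr_ge0 ?mulr_ge0 ?exprn_ge0 ?ltW.
Qed.

(* By [upper_ratio_step], [P(N < n) + P(N = n) * upper_ratio x n] is
   nonincreasing in [n], and its limit is at least 1. *)
Lemma upper_tail x n : 0 < x -> x < n%:R ->
  1 - pcdf n x <= ppmf x n * upper_ratio x n.
Proof.
move=> x0 xn; rewrite lerBlDr.
have H k : pcdf (n + k) x + ppmf x (n + k) * upper_ratio x (n + k) <=
           ppmf x n * upper_ratio x n + pcdf n x.
  elim: k => [|k IH]; first by rewrite addn0 addrC.
  apply: le_trans IH; rewrite addnS pcdfS -addrA lerD2l ppmfS.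
  have xnk : x < (n + k)%:R by rewrite (lt_le_trans xn)// ler_nat leq_addr.
  apply: le_trans (ler_wpM2l (ppmf_ge0 _ (ltW x0)) (upper_ratio_step x0 xnk)).
  by rewrite le_eqVlt; apply/orP; left; apply/eqP; ring.
have c : pcdf (k + n) x @[k --> \oo] --> (1 : R).
  by rewrite (cvg_shiftn n (fun k => pcdf k x)); exact: cvg_pcdf.
rewrite -(cvg_lim _ c)//; apply: limr_le; first by apply/cvg_ex; exists 1.
apply: nearW => k; rewrite addnC; apply: le_trans (H k).
rewrite lerDl mulr_ge0 ?(ppmf_ge0 _ (ltW x0))//; apply: upper_ratio_ge0 => //.
by rewrite (lt_le_trans xn)// ler_nat leq_addr.
Qed.

(** Counterpart of [upper_ratio_step]. For [m = 0] equality holds, as [lower_ratio x 0 = 1];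
    otherwise the excess is an explicit nonnegative fraction. *)
Lemma lower_ratio_step x m : m.+1%:R < x ->
  1 + m.+1%:R / x * lower_ratio x m <= lower_ratio x m.+1.
Proof.
rewrite /lower_ratio /=; case: m => [|m].
  rewrite subr0 !mul0r !addr0 mul1r => x1.
  set N := (x + 2) * (x + 4) + 2 * 0 - 2.
  set M := (x - 1 + 2) * (x - 1 + 4) + 2 * 1 - 2.
  have N0 : 0 < N by rewrite /N; nra.
  have M0 : 0 < (x - 1) * M + 1 * (x - 1 + 4) by rewrite /M; nra.
  rewrite (_ : x^-1 * _ = x^-1); last first.
    by rewrite divff ?mulr1// mulf_neq0// gt_eqF//; lra.
  rewrite (_ : x * M / _ = 1 + x^-1)//.
  have -> : (x - 1) * M + 1 * (x - 1 + 4) = x * (x * (x + 3)) by rewrite /M; ring.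
  by rewrite /M; field; rewrite !gt_eqF//; lra.
move=> mx; have m0 : 0 <= m%:R :> R by [].
move: mx; rewrite -[m.+2%:R]natr1 -[m.+1%:R]natr1.
set u : R := m%:R in m0 *.
move=> mx.
have [y y0 ->] : exists2 y, 0 < y & x = u + 1 + 1 + y.
  by exists (x - (u + 1 + 1)); [rewrite subr_gt0|ring].
have -> : u + 1 + 1 + y - (u + 1 + 1) = y by ring.
have -> : u + 1 + 1 + y - (u + 1) = y + 1 by ring.
set N := (y + 2) * (y + 4) + 2 * (u + 1 + 1) - 2.
set M := (y + 1 + 2) * (y + 1 + 4) + 2 * (u + 1) - 2.
have N0 : 0 < N by rewrite /N; nra.
have M0 : 0 < M by rewrite /M; nra.
set D := y * N + (u + 1 + 1) * (y + 4).
set E := (y + 1) * M + (u + 1) * (y + 1 + 4).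
have D0 : 0 < D by rewrite /D; nra.
have E0 : 0 < E by rewrite /E; nra.
have xy : 0 < u + 1 + 1 + y by lra.
rewrite -subr_ge0.
set a := u + 1 + 1.
have -> : (a + y) * N / D - (1 + a / (a + y) * ((a + y) * M / E)) =
    6 * a * (u + 1) * u / (D * E).
  rewrite [RHS](_ : _ = ((a + y) * N * E - D * E - a * M * D) / (D * E)).
    by field; rewrite !gt_eqF.
  by congr (_ / _); rewrite /D /E /M /N /a; ring.
apply: divr_ge0; last by rewrite ltW// mulr_gt0.
have a0 : 0 <= a by rewrite /a; lra.
by rewrite !mulr_ge0//; lra.
Qed.

(** The lower tail is a finite sum, so induction from the exact case [m = 0] replaces the limit used
    for [upper_tail]. *)
Lemma lower_tail x m : m%:R < x -> pcdf m.+1 x <= ppmf x m * lower_ratio x m.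
Proof.
elim: m => [|m IH] mx.
  rewrite pcdfS pcdf0 add0r /lower_ratio subr0 mul0r addr0 divff ?mulr1//.
  by rewrite gt_eqF//; nra.
have m0 : 0 <= m%:R :> R by [].
have mx' : m%:R + 1 < x by rewrite natr1.
rewrite pcdfS; apply: (@le_trans _ _ (ppmf x m * lower_ratio x m + ppmf x m.+1)).
  by rewrite lerD2r IH//; lra.
have x0 : 0 < x by lra.
have -> : ppmf x m = m.+1%:R / x * ppmf x m.+1.
  by rewrite ppmfS -natr1; field; rewrite !gt_eqF//; lra.
apply: le_trans (ler_wpM2l (ppmf_ge0 _ (ltW x0)) (lower_ratio_step mx)).
by rewrite le_eqVlt; apply/orP; left; apply/eqP; ring.
Qed.

End Tails.

(** * Logarithm estimates and an explicit Stirling bound *)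

Section Stirling.
Variable R : realType.
Implicit Types (x y z c : R) (k m n : nat).

Lemma is_derive_affine c x : is_derive x 1 (fun z : R => 1 + c * z) c.
Proof.
have -> : (fun z : R => 1 + c * z) = cst 1 + c \*: id by apply/funext.
by apply: is_derive_eq; rewrite add0r /GRing.scale/= mulr1.
Qed.

Lemma is_derive_ln_affine c x : 0 < 1 + c * x ->
  is_derive x 1 (fun z : R => ln (1 + c * z)) (c / (1 + c * x)).
Proof.
move=> h; rewrite mulrC.
exact: (@is_derive1_comp _ (@ln R) (fun z => 1 + c * z) x _ _
  (is_derive1_ln h) (is_derive_affine c x)).
Qed.

Lemma is_derive_inv_affine c x : 0 < 1 + c * x ->
  is_derive x 1 (fun z : R => (1 + c * z)^-1) (- c / (1 + c * x) ^+ 2).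
Proof.
move=> h.
have := @is_deriveV _ (fun z : R => 1 + c * z) x c 1 _ (is_derive_affine c x).
rewrite gt_eqF// => /(_ erefl) D; apply: is_derive_eq.
by rewrite /GRing.scale/= mulrC mulrN mulNr.
Qed.

(* Twice the inverse hyperbolic tangent, whose Taylor bounds are sharper than
   those of [ln (1 + z)]. *)
Definition lnq z : R := ln (1 + 1 * z) - ln (1 + -1 * z).

Lemma is_derive_lnq z : -1 < z < 1 -> is_derive z 1 lnq (2 / (1 - z ^+ 2)).
Proof.
move=> /andP[z0 z1].
have h1 : 0 < 1 + 1 * z by lra.
have h2 : 0 < 1 + -1 * z by lra.
have D1 := is_derive_ln_affine h1; have D2 := is_derive_ln_affine h2.
have -> : lnq = (fun z : R => ln (1 + 1 * z)) - (fun z : R => ln (1 + -1 * z)) by [].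
apply: is_derive_eq.
have -> : 1 - z ^+ 2 = (1 + 1 * z) * (1 + -1 * z) by ring.
by field; rewrite !gt_eqF//; lra.
Qed.

Lemma lnq0 : lnq 0 = 0.
Proof. by rewrite /lnq !mulr0 !addr0 ln1 subrr. Qed.

(** Truncation of the series [2 (z + z^3 / 3 + z^5 / 5 + ...)] after two terms. *)
Lemma lnq_ge z : 0 <= z < 1 -> 2 * z + 2 / 3 * z ^+ 3 <= lnq z.
Proof.
move=> /andP[z0 z1].
pose f : R -> R := lnq - (2 \*: id + (2 / 3) \*: (id ^+ 3)).
have fE y : f y = lnq y - (2 * y + 2 / 3 * y ^+ 3) by [].
suff : f 0 <= f z.
  by rewrite !fE lnq0 mulr0 expr0n/= mulr0 addr0 subr0 subr_ge0.
apply: (@is_derive_ndecr _ f (fun x => 2 / (1 - x ^+ 2) - (2 + 2 * x ^+ 2))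
  _ _ z0) => x /andP[x0 xz].
  have /is_derive_lnq D : -1 < x < 1 by apply/andP; split; lra.
  by apply: is_derive_eq; rewrite /GRing.scale/=; congr (_ - _); field.
have h : 0 < 1 - x ^+ 2 by nra.
rewrite (_ : _ - _ = 2 * x ^+ 4 / (1 - x ^+ 2)); last first.
  by field; rewrite gt_eqF.
by rewrite divr_ge0 ?mulr_ge0 ?exprn_ge0// ltW.
Qed.

(** In the same series, every coefficient after the first is replaced by [1 / 3], and the geometric
    series is summed. *)
Lemma lnq_le z : 0 <= z < 1 -> lnq z <= 2 * z + 2 / 3 * (z ^+ 3 / (1 - z ^+ 2)).
Proof.
move=> /andP[z0 z1].
pose f : R -> R := ((4 / 3) \*: id +
  3^-1 \*: ((fun z : R => (1 + -1 * z)^-1) - (fun z : R => (1 + 1 * z)^-1))) - lnq.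
(* Partial fractions make the bound easy to differentiate. *)
have E : 2 * z + 2 / 3 * (z ^+ 3 / (1 - z ^+ 2)) =
    4 / 3 * z + 3^-1 * ((1 + -1 * z)^-1 - (1 + 1 * z)^-1).
  by field; rewrite !gt_eqF//; nra.
have fE y : f y = 4 / 3 * y + 3^-1 * ((1 + -1 * y)^-1 - (1 + 1 * y)^-1) - lnq y by [].
suff : f 0 <= f z.
  by rewrite !fE -E lnq0 !mulr0 !addr0 subrr mulr0 addr0 subr0 subr_ge0.
apply: (@is_derive_ndecr _ f (fun x => (4 / 3 + 3^-1 * (1 / (1 + -1 * x) ^+ 2
   + 1 / (1 + 1 * x) ^+ 2)) - 2 / (1 - x ^+ 2)) _ _ z0) => x /andP[x0 xz].
  have /is_derive_lnq D : -1 < x < 1 by apply/andP; split; lra.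
  have h1 : 0 < 1 + 1 * x by lra.
  have h2 : 0 < 1 + -1 * x by lra.
  have D1 := is_derive_inv_affine h1; have D2 := is_derive_inv_affine h2.
  apply: is_derive_eq; rewrite /GRing.scale/=; field.
  by rewrite !gt_eqF//; nra.
have h : 0 < 1 - x ^+ 2 by nra.
rewrite (_ : _ - _ = 4 / 3 * x ^+ 4 / (1 - x ^+ 2) ^+ 2); last first.
  by field; rewrite !gt_eqF//; nra.
by rewrite divr_ge0 ?mulr_ge0 ?exprn_ge0// ltW.
Qed.

Lemma lnqE a b : 0 < b -> 0 < a -> lnq ((a - b) / (a + b)) = ln a - ln b.
Proof.
move=> b0 a0; rewrite /lnq.
have -> : 1 + 1 * ((a - b) / (a + b)) = 2 * a / (a + b).
  by field; rewrite gt_eqF//; lra.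
have -> : 1 + -1 * ((a - b) / (a + b)) = 2 * b / (a + b).
  by field; rewrite gt_eqF//; lra.
have ab : 0 < a + b by lra.
rewrite !ln_div ?posrE ?mulr_gt0//; rewrite !lnM ?posrE//; ring.
Qed.

(* The constant [11 / 12] makes the case [n = 0] an equality; the
   limiting constant in Stirling's formula is [ln (2 * pi) / 2 = 0.918...]. *)
Lemma ln_fact_ge n :
  (n.+1%:R + 2^-1) * ln n.+1%:R - n.+1%:R + 11 / 12 + (12 * n.+1%:R)^-1
    <= ln (n.+1`!%:R : R).
Proof.
elim: n => [|n IH]; first by rewrite factS fact0 muln1 ln1; lra.
have n0 : 0 < n.+1%:R :> R by rewrite ltr0n.
have f0 : 0 < n.+1`!%:R :> R by rewrite ltr0n fact_gt0.
rewrite factS natrM lnM ?posrE//.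
rewrite -[n.+2%:R]natr1; move: IH n0; set u := n.+1%:R => IH u0.
have := @lnq_le ((u + 1 - u) / (u + 1 + u)).
have u1 : 0 < u + 1 by lra.
rewrite (lnqE u0 u1).
have z0 : 0 <= (u + 1 - u) / (u + 1 + u) < 1.
  by rewrite divr_ge0//= ?ltr_pdivrMr; lra.
move=> /(_ z0) H.
(* At [z = 1 / (2 u + 1)] the bound of [lnq_le] becomes exactly this telescoping difference. *)
have {}H : (u + 2^-1) * (ln (u + 1) - ln u) <= 1 + (12 * u)^-1 - (12 * (u + 1))^-1.
  have -> : 1 + (12 * u)^-1 - (12 * (u + 1))^-1 = (u + 2^-1) *
     (2 * ((u + 1 - u) / (u + 1 + u)) +
      2 / 3 * (((u + 1 - u) / (u + 1 + u)) ^+ 3 /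
        (1 - ((u + 1 - u) / (u + 1 + u)) ^+ 2))).
    by field; rewrite !gt_eqF//; nra.
  by rewrite ler_wpM2l//; lra.
by move: IH H; set A := (12 * u)^-1; set B := (12 * (u + 1))^-1; lra.
Qed.

(** Stirling's bound with the positive correction [1 / (12 n)] dropped. *)
Lemma ppmf_le x n : 0 < x ->
  ppmf x n.+1 <= expR (n.+1%:R - x - n.+1%:R * (ln n.+1%:R - ln x) - 11 / 12)
                 / Num.sqrt n.+1%:R.
Proof.
move=> x0.
have n0 : 0 < n.+1%:R :> R by rewrite ltr0n.
have f0 : 0 < n.+1`!%:R :> R by rewrite ltr0n fact_gt0.
have -> : ppmf x n.+1 = expR (ln x *+ n.+1 - ln n.+1`!%:R - x).
  by rewrite !expRD !expRN lnK ?posrE// -lnXn// lnK ?posrE ?exprn_gt0// /ppmf expRN.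
have -> : (Num.sqrt n.+1%:R)^-1 = expR (- (2^-1 * ln n.+1%:R)) :> R.
  rewrite expRN; congr (_^-1); rewrite -powR12_sqrt ?ltW// /powR gt_eqF//.
rewrite -expRD ler_expR -(mulr_natr (ln x)).
have := ln_fact_ge n; have : 0 < (12 * n.+1%:R : R)^-1 by rewrite invr_gt0 mulr_gt0.
set A := (12 * _)^-1.
by set u := n.+1%:R; lra.
Qed.

End Stirling.

(** * Rational bounds for the exponential *)

Section ExpBounds.
Variable R : realType.
Implicit Types (x s t : R) (k m n : nat).

(* [1 + x/(k+1) (1 + x/(k+2) (... (1 + x/(k+n) r)))]: the nested form lets
   [lra] evaluate truncated exponential series without computing factorials. *)
Fixpoint exp_horner (r : R) n k x : R :=
  if n is n'.+1 then 1 + x / k.+1%:R * exp_horner r n' k.+1 x else r.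

Lemma exp_hornerE r n j x :
  exp_horner r n j x = \sum_(k < n) x ^+ k * (j`!%:R / (j + k)`!%:R)
                       + x ^+ n * (j`!%:R / (j + n)`!%:R) * r.
Proof.
have f k : k`!%:R != 0 :> R by rewrite pnatr_eq0 -lt0n fact_gt0.
have key j' (a p : R) :
    x / j'.+1%:R * (p * (j'.+1`!%:R * a)) = x * p * (j'`!%:R * a).
  rewrite factS natrM; move: (factS_neq0 R j'); move: (j'.+1%:R : R) => u u0.
  by field; rewrite u0.
elim: n j => [|n IH] j.
  by rewrite big_ord0 add0r expr0 addn0 divff// !mul1r.
rewrite big_ord_recl/= expr0 addn0 divff// mulr1 IH mulrDr mulr_sumr -addrA.
congr (_ + (_ + _)).
  apply: eq_bigr => k _.
  by rewrite key /bump leq0n add1n addnS -addSn exprS.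
by rewrite mulrA key addnS -addSn exprS.
Qed.

Lemma pcdf_horner n x : pcdf n x = exp_horner 0 n 0 x * expR (- x).
Proof.
rewrite exp_hornerE mulr0 addr0 /pcdf mulr_suml; apply: eq_bigr => k _.
by rewrite fact0 div1r add0n.
Qed.

Lemma exp_horner_le_expR n x : 0 <= x -> exp_horner 0 n 0 x <= expR x.
Proof.
move=> x0; have := pcdf_le1 n x0.
by rewrite pcdf_horner expRN ler_pdivrMr ?expR_gt0// mul1r.
Qed.

(** The remainder after [n] terms is at most its first term times [n / (n - x)], the sum of the
    geometric series of ratio [x / n]. *)
Lemma expR_le_exp_horner r n x : 0 < x -> x < n%:R -> n%:R <= r * (n%:R - x) ->
  expR x <= exp_horner r n 0 x.
Proof.
move=> x0 xn nr; have := upper_tail x0 xn.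
have y0 : 0 < n%:R - x by rewrite subr_gt0.
have rU : upper_ratio x n <= r.
  apply: (@le_trans _ _ (n%:R / (n%:R - x))); last by rewrite ler_pdivrMr.
  rewrite /upper_ratio /=; set y := n%:R - x in y0 *.
  set N := (y + 1) * (y + 2) + 2 * x.
  have N0 : 0 < N by rewrite /N; nra.
  rewrite ler_pdivrMr; last by nra.
  rewrite mulrAC -mulrA ler_wpM2l// ler_pdivlMr// mulrC lerDl.
  by rewrite mulr_ge0//; lra.
rewrite exp_hornerE /pcdf /ppmf -mulr_suml lerBlDr fact0 add0n div1r.
under [in X in _ -> X]eq_bigr do rewrite add0n div1r.
set S := \sum_(_ < n) _; rewrite expRN.
have := expR_gt0 x; set e := expR x => e0.
have -> : x ^+ n / n`!%:R / e * upper_ratio x n + S / e =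
    (S + x ^+ n / n`!%:R * upper_ratio x n) / e by ring.
rewrite ler_pdivlMr// mul1r => /le_trans; apply.
by rewrite lerD2l ler_wpM2l// divr_ge0// exprn_ge0// ltW.
Qed.

Lemma expR17_12 : 4123 / 1000 <= expR (17 / 12 : R).
Proof.
by apply: (le_trans _ (@exp_horner_le_expR 10 _ _)); rewrite /exp_horner; lra.
Qed.

Lemma expR339_250 : 1551 / 400 <= expR (339 / 250 : R).
Proof.
by apply: (le_trans _ (@exp_horner_le_expR 11 _ _)); rewrite /exp_horner; lra.
Qed.

End ExpBounds.

(** * Tails when a window end point is an integer *)

Section TailBounds.
Variable R : realType.
Implicit Types (x s t : R) (k m n : nat).

(* The rational parts of the squared tail bounds in [upper_tail_le] and
   [lower_tail_le]: after the shift of [s] all coefficients are positive. *)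
Lemma upper_poly s : 237 / 100 <= s ->
  (s + 1) * (3 * s ^+ 2 + 3 * s + 2) ^+ 2
    <= 73 / 100 * s * (4 * s ^+ 2 + 5 * s + 2) ^+ 2.
Proof.
move=> hs; have [t t0 ->] : exists2 t, 0 <= t & s = 237 / 100 + t.
  by exists (s - 237 / 100); [rewrite subr_ge0|ring].
have t2 := exprn_ge0 2 t0; have t3 := exprn_ge0 3 t0; have t4 := exprn_ge0 4 t0.
have t5 := exprn_ge0 5 t0; lra.
Qed.

Lemma lower_poly s : 256 / 100 <= s ->
  s * ((6 * s - 3) * (3 * s ^+ 2 + 4 * s + 6)) ^+ 2
    <= 879 / 1000 * (s - 1) * ((6 * s - 2) * (4 * s ^+ 2 + 7 * s + 2)) ^+ 2.
Proof.
move=> hs; have [t t0 ->] : exists2 t, 0 <= t & s = 256 / 100 + t.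
  by exists (s - 256 / 100); [rewrite subr_ge0|ring].
have t2 := exprn_ge0 2 t0; have t3 := exprn_ge0 3 t0; have t4 := exprn_ge0 4 t0.
have t5 := exprn_ge0 5 t0; have t6 := exprn_ge0 6 t0; have t7 := exprn_ge0 7 t0.
lra.
Qed.

Lemma ler_inv (a b : R) : a <= b -> 0 < a -> b^-1 <= a^-1.
Proof. by move=> ab a0; rewrite lef_pV2 ?posrE// (lt_le_trans a0). Qed.

Lemma ler_sqrt_div (a b c : R) : 0 < b -> 0 <= c ->
  a ^+ 2 <= c ^+ 2 * b -> a / Num.sqrt b <= c.
Proof.
move=> b0 c0 h; rewrite ler_pdivrMr ?sqrtr_gt0//.
have -> : c * Num.sqrt b = Num.sqrt (c ^+ 2 * b).
  by rewrite sqrtrM ?sqr_ge0// sqrtr_sqr ger0_norm.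
by rewrite (le_trans (ler_norm _))// -sqrtr_sqr ler_wsqrtr.
Qed.

(* The bounds here and in [lower_tail_le] add up to [56 / 125]. *)
Lemma upper_tail_le n s : 237 / 100 <= s -> n%:R = s ^+ 2 + s ->
  1 - pcdf n (s ^+ 2) <= 551 / 2500.
Proof.
case: n => [|n] hs nE; first by exfalso; nra.
have s2 : 0 < s ^+ 2 by nra.
apply: le_trans (upper_tail s2 _) _; first by rewrite nE; lra.
have -> : upper_ratio (s ^+ 2) n.+1 =
    (s + 1) * (3 * s ^+ 2 + 3 * s + 2) / (4 * s ^+ 2 + 5 * s + 2).
  rewrite /upper_ratio nE (_ : s ^+ 2 + s - s ^+ 2 = s); last by ring.
  rewrite /=; field; rewrite !gt_eqF//; nra.
set q := (s + 1) * (3 * s ^+ 2 + 3 * s + 2) / (4 * s ^+ 2 + 5 * s + 2).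
have q0 : 0 <= q by rewrite divr_ge0//; nra.
apply: le_trans (ler_wpM2r q0 (ppmf_le _ s2)) _.
rewrite nE -lnqE//; last by nra.
set v := 2 * s + 1.
have vE : (s ^+ 2 + s - s ^+ 2) / (s ^+ 2 + s + s ^+ 2) = v^-1.
  by rewrite /v; field; rewrite !gt_eqF//; nra.
rewrite vE.
have v0 : 574 / 100 <= v by rewrite /v; lra.
have vi : 0 <= v^-1 < 1 by rewrite invr_ge0 invf_lt1; lra.
have vi2 : v^-1 <= 100 / 574.
  have vv : v * v^-1 = 1 by rewrite mulfV// gt_eqF//; lra.
  have : 0 <= (v - 574 / 100) * v^-1.
    by apply: mulr_ge0; [rewrite subr_ge0|case/andP: vi].
  by rewrite mulrBl vv; lra.
(* As [s^2 + s = (v^2 - 1) / 4], [lnq_ge] bounds the exponent by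
   [- 17 / 12 + 1 / (3 v) + 1 / (6 v^3)], which is below [- 339 / 250] once [v >= 574 / 100]. *)
apply: (@le_trans _ _ (expR (- (339 / 250)) / Num.sqrt (s ^+ 2 + s) * q)).
  rewrite ler_wpM2r// ler_wpM2r ?invr_ge0 ?sqrtr_ge0// ler_expR.
  have := ler_wpM2l (_ : 0 <= s ^+ 2 + s) (lnq_ge vi).
  rewrite (_ : 0 <= s ^+ 2 + s); last by nra.
  move=> /(_ erefl).
  have -> : (s ^+ 2 + s) * (2 * v^-1 + 2 / 3 * v^-1 ^+ 3) =
    s + 2^-1 - v^-1 / 3 - v^-1 ^+ 3 / 6.
    by rewrite /v; field; rewrite !gt_eqF//; lra.
  move: vi vi2; set z := v^-1 => /andP[z0 _] z1.
  have H (c : R) : z <= c -> z ^+ 3 <= c ^+ 3.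
    by move=> zc; rewrite lerXn2r ?nnegrE// (le_trans z0).
  by have := H _ z1; lra.
rewrite expRN -mulrA [_ * q]mulrC.
(* [1709 / 2000] is just above the square root of the [73 / 100] in [upper_poly]. *)
have h : q / Num.sqrt (s ^+ 2 + s) <= 1709 / 2000.
  apply: ler_sqrt_div; [nra|lra|].
  have d0 : 0 < 4 * s ^+ 2 + 5 * s + 2 by nra.
  rewrite /q expr_div_n ler_pdivrMr ?exprn_gt0//.
  have := upper_poly hs.
  set A := (3 * s ^+ 2 + 3 * s + 2); set B := (4 * s ^+ 2 + 5 * s + 2) => H.
  have B2 : 0 <= B ^+ 2 by rewrite sqr_ge0.
  have : (s + 1) * ((s + 1) * A ^+ 2) <= (s + 1) * (73 / 100 * s * B ^+ 2).
    by rewrite ler_wpM2l//; lra.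
  have : 0 <= (s + 1) * s * B ^+ 2 by apply: mulr_ge0 => //; apply: mulr_ge0; lra.
  rewrite exprMn; lra.
have e := expR339_250 R.
have e0 : (expR (339 / 250 : R))^-1 <= (1551 / 400)^-1.
  by apply: (ler_inv e); lra.
apply: le_trans (ler_pM _ _ e0 h) _; last lra.
  by rewrite invr_ge0 expR_ge0.
by rewrite divr_ge0 ?sqrtr_ge0.
Qed.

Lemma lower_tail_le m s : 256 / 100 <= s -> m%:R = s ^+ 2 - s ->
  pcdf m.+1 (s ^+ 2) <= 569 / 2500.
Proof.
case: m => [|m] hs mE; first by exfalso; nra.
have s2 : 0 < s ^+ 2 by nra.
have d0 : 0 < 4 * s ^+ 2 + 7 * s + 2 by nra.
apply: le_trans (lower_tail _) _; first by rewrite mE; lra.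
have -> : lower_ratio (s ^+ 2) m.+1 =
    s * (3 * s ^+ 2 + 4 * s + 6) / (4 * s ^+ 2 + 7 * s + 2).
  rewrite /lower_ratio mE (_ : s ^+ 2 - (s ^+ 2 - s) = s); last by ring.
  rewrite /=; field; rewrite !gt_eqF//; nra.
set q := s * (3 * s ^+ 2 + 4 * s + 6) / (4 * s ^+ 2 + 7 * s + 2).
have q0 : 0 <= q by rewrite divr_ge0//; nra.
apply: le_trans (ler_wpM2r q0 (ppmf_le _ s2)) _.
rewrite mE -[ln _ - _]opprB -lnqE//; last by nra.
set w := 2 * s - 1.
have wE : (s ^+ 2 - (s ^+ 2 - s)) / (s ^+ 2 + (s ^+ 2 - s)) = w^-1.
  by rewrite /w; field; rewrite !gt_eqF//; nra.
rewrite wE.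
have w0 : 4 <= w by rewrite /w; lra.
have wi : 0 <= w^-1 < 1 by rewrite invr_ge0 invf_lt1; lra.
(* [17 / 12] is the Stirling constant [11 / 12] plus the [1 / 2] coming from [lnq_le]. *)
apply: (@le_trans _ _ (expR (- (17 / 12) - (6 * s - 3)^-1) /
                        Num.sqrt (s ^+ 2 - s) * q)).
  rewrite ler_wpM2r// ler_wpM2r ?invr_ge0 ?sqrtr_ge0// ler_expR.
  have := ler_wpM2l (_ : 0 <= s ^+ 2 - s) (lnq_le wi).
  rewrite (_ : 0 <= s ^+ 2 - s); last by nra.
  move=> /(_ erefl).
  have -> : (s ^+ 2 - s) * (2 * w^-1 + 2 / 3 * (w^-1 ^+ 3 / (1 - w^-1 ^+ 2))) =
    s - 2^-1 - (6 * s - 3)^-1.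
    by rewrite /w; field; rewrite !gt_eqF//; nra.
  lra.
(* The remaining correction becomes a rational factor through [1 + y <= expR y]. *)
have e : expR (- (6 * s - 3)^-1) <= (6 * s - 3) / (6 * s - 2).
  rewrite expRN -[leRHS]invf_div lef_pV2 ?posrE ?expR_gt0 ?divr_gt0//; try lra.
  apply: le_trans (expR_ge1Dx _).
  rewrite le_eqVlt; apply/orP; left; apply/eqP.
  by field; rewrite !gt_eqF//; lra.
have e' : expR (- (17 / 12) : R) <= (4123 / 1000)^-1.
  by rewrite expRN; apply: (ler_inv (expR17_12 R)); lra.
(* [469 / 500] is just above the square root of the [879 / 1000] in [lower_poly]. *)
have h : (6 * s - 3) / (6 * s - 2) * q / Num.sqrt (s ^+ 2 - s) <= 469 / 500.
  apply: ler_sqrt_div; [nra|lra|].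
  rewrite /q [_ * (_ / _)](_ : _ = s * ((6 * s - 3) * (3 * s ^+ 2 + 4 * s + 6))
    / ((6 * s - 2) * (4 * s ^+ 2 + 7 * s + 2))); last first.
    by field; rewrite !gt_eqF//; nra.
  have c0 : 0 < 6 * s - 2 by lra.
  rewrite expr_div_n ler_pdivrMr ?exprn_gt0 ?mulr_gt0//.
  have := lower_poly hs.
  set A := (6 * s - 3) * _; set B := (6 * s - 2) * _ => H.
  have B2 : 0 <= B ^+ 2 by rewrite sqr_ge0.
  have : s * (s * A ^+ 2) <= s * (879 / 1000 * (s - 1) * B ^+ 2).
    by rewrite ler_wpM2l//; lra.
  have : 0 <= s * (s - 1) * B ^+ 2 by apply: mulr_ge0 => //; apply: mulr_ge0; lra.
  rewrite exprMn; lra.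
have ab : expR (- (17 / 12)) * expR (- (6 * s - 3)^-1) <=
    (4123 / 1000)^-1 * ((6 * s - 3) / (6 * s - 2)).
  by apply: ler_pM => //; exact: expR_ge0.
have qs : 0 <= q / Num.sqrt (s ^+ 2 - s) by rewrite divr_ge0 ?sqrtr_ge0.
rewrite mulrAC -mulrA expRD; apply: le_trans (ler_wpM2r qs ab) _.
have K0 : 0 <= (4123 / 1000)^-1 :> R by lra.
apply: (@le_trans _ _ ((4123 / 1000)^-1 * (469 / 500))); last lra.
rewrite -mulrA; apply: (ler_wpM2l K0).
by rewrite mulrA.
Qed.

End TailBounds.

(** * Lower bounds for the mass of the window, with numerical values *)

Section Window.
Variable R : realType.
Implicit Types (x s t : R) (k m n : nat).

Definition within_sd x : set nat := [set n | `|n%:R - x| <= Num.sqrt x].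

Lemma within_sd_ge x s m n : 0 < s -> x = s ^+ 2 -> (m <= n.+1)%N ->
  x - s <= m%:R -> n%:R <= x + s ->
  pcdf n.+1 x - pcdf m x <= fine (poissonP x (within_sd x)).
Proof.
move=> s0 xE mn xm nx.
have x0 : 0 < x by rewrite xE exprn_gt0.
apply: poissonP_ge => // k /andP[mk kn].
rewrite /within_sd /= xE sqrtr_sqr (ger0_norm (ltW s0)) -xE.
have mk' : m%:R <= k%:R :> R by rewrite ler_nat.
have kn' : k%:R <= n%:R :> R by rewrite ler_nat.
by rewrite ler_norml; apply/andP; split; lra.
Qed.

(** Multiplying by [expR x], itself bounded above by [K] terms and a remainder, leaves an inequality
    between rational expressions in [x]. *)
Lemma window_ge (c r : R) x m n K : 0 < x -> x < K%:R -> K%:R <= r * (K%:R - x) ->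
  0 <= c -> c * exp_horner r K 0 x <= exp_horner 0 n 0 x - exp_horner 0 m 0 x ->
  c <= pcdf n x - pcdf m x.
Proof.
move=> x0 xK Kr c0 h; rewrite !pcdf_horner -mulrBl expRN ler_pdivlMr ?expR_gt0//.
by apply: le_trans h; rewrite ler_wpM2l// expR_le_exp_horner.
Qed.

Lemma expRN1_le : 3 / 2 * expR (-1) <= 69 / 125 :> R.
Proof.
have e : exp_horner 0 8 0 1 <= expR 1 :> R by apply: exp_horner_le_expR; lra.
have e' : 2718 / 1000 <= expR 1 :> R by apply: le_trans e; rewrite /exp_horner; lra.
have h : expR (-1) <= (2718 / 1000)^-1 :> R.
  by rewrite expRN; apply: (ler_inv e'); lra.
lra.
Qed.

(* By [expRN1_le], [69 / 125 = 1 - 56 / 125] exceeds the claimed infimum. *)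
Lemma window13 : 69 / 125 <= pcdf 3 (17 / 10 : R) - pcdf 1 (17 / 10).
Proof.
by apply: (@window_ge _ 3 _ _ _ 7); rewrite /exp_horner; lra.
Qed.

Lemma window14a : 69 / 125 <= pcdf 4 (17 / 10 : R) - pcdf 1 (17 / 10).
Proof.
by apply: (@window_ge _ 3 _ _ _ 7); rewrite /exp_horner; lra.
Qed.

Lemma window14b : 69 / 125 <= pcdf 4 (21 / 8 : R) - pcdf 1 (21 / 8).
Proof.
by apply: (@window_ge _ 3 _ _ _ 7); rewrite /exp_horner; lra.
Qed.

Lemma window25a : 69 / 125 <= pcdf 5 (13 / 5 : R) - pcdf 2 (13 / 5).
Proof.
by apply: (@window_ge _ 3 _ _ _ 7); rewrite /exp_horner; lra.
Qed.

Lemma window25b : 69 / 125 <= pcdf 5 (10 / 3 : R) - pcdf 2 (10 / 3).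
Proof.
by apply: (@window_ge _ 3 _ _ _ 7); rewrite /exp_horner; lra.
Qed.

Lemma window26a : 69 / 125 <= pcdf 6 (10 / 3 : R) - pcdf 2 (10 / 3).
Proof.
by apply: (@window_ge _ 3 _ _ _ 7); rewrite /exp_horner; lra.
Qed.

Lemma window26b : 69 / 125 <= pcdf 6 (4 : R) - pcdf 2 4.
Proof.
by apply: (@window_ge _ 3 _ _ _ 7); rewrite /exp_horner; lra.
Qed.

Lemma window37a : 69 / 125 <= pcdf 7 (4 : R) - pcdf 3 4.
Proof.
by apply: (@window_ge _ 3 _ _ _ 7); rewrite /exp_horner; lra.
Qed.

Lemma window37b : 69 / 125 <= pcdf 7 (16 / 3 : R) - pcdf 3 (16 / 3).
Proof.
by apply: (@window_ge _ 3 _ _ _ 9); rewrite /exp_horner; lra.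
Qed.

Lemma pcdf4_le : pcdf 4 (53 / 10) <= 569 / 2500 :> R.
Proof.
rewrite pcdf_horner expRN ler_pdivrMr ?expR_gt0//.
have := @exp_horner_le_expR R 14 (53 / 10).
by rewrite /exp_horner; lra.
Qed.

End Window.

(** * Case analysis on the parameter *)

Section Main.
Variable R : realType.
Implicit Types (x s t : R) (k m n : nat).

Lemma sqr_subr_root m : exists2 t : R, 1 <= t & m%:R = t ^+ 2 - t.
Proof.
have m0 : 0 <= m%:R :> R by [].
have h : 0 <= 1 + 4 * m%:R :> R by lra.
exists ((1 + Num.sqrt (1 + 4 * m%:R)) / 2).
  have : 1 <= Num.sqrt (1 + 4 * m%:R) :> R.
    by rewrite -[leLHS]sqrtr1 ler_wsqrtr//; lra.
  lra.
have := sqr_sqrtr h; set r := Num.sqrt _ => rE.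
rewrite (_ : _ - _ = (r ^+ 2 - 1) / 4); last by field.
by rewrite rE; field.
Qed.

Lemma sqr_addr_root n : exists2 t : R, 0 <= t & n%:R = t ^+ 2 + t.
Proof.
have [t t1 nE] := sqr_subr_root n.
by exists (t - 1); [lra|rewrite nE; ring].
Qed.

Lemma within_sd_ge_large x s : 0 < s -> x = s ^+ 2 -> 3 <= s ^+ 2 - s ->
  69 / 125 <= fine (poissonP x (within_sd x)).
Proof.
move=> s0 xE s3.
have sge : 23 / 10 <= s by nra.
have x0 : 0 < x by rewrite xE exprn_gt0.
have xs0 : 0 <= x - s by rewrite xE; lra.
have xs1 : 0 <= x + s by lra.
(* The range used starts at [m.+1]; if [x - s] is an integer, the point [m] of the window is given
   up. *)
pose m := Num.truncn (x - s); pose n := Num.truncn (x + s).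
have /andP[m1 m2] : m%:R <= x - s < m.+1%:R by exact: truncn_itv.
have /andP[n1 n2] : n%:R <= x + s < n.+1%:R by exact: truncn_itv.
have mn : (m.+1 <= n.+1)%N.
  by rewrite -(ltr_nat R); lra.
apply: le_trans (within_sd_ge s0 xE mn (ltW m2) n1).
have m3 : (3 <= m)%N by rewrite -ltnS -(ltr_nat R) (le_lt_trans _ m2)// xE.
have n8 : (8 <= n.+1)%N.
  by rewrite -(ltr_nat R); apply: le_lt_trans n2; rewrite xE; nra.
have U : 1 - pcdf n.+1 x <= 551 / 2500.
  have [t t0 nE] := sqr_addr_root n.+1.
  have n8' : 8 <= n.+1%:R :> R by rewrite ler_nat.
  (* The positive root of [t^2 + t = 8] is 2.372... *)
  have ht : 237 / 100 <= t by nra.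
  have st : s <= t by nra.
  apply: le_trans (upper_tail_le ht nE).
  by rewrite lerD2l lerN2 pcdf_nincr// ?(ltW x0)// xE; nra.
have L : pcdf m.+1 x <= 569 / 2500.
  (* For [m = 3] the root [t] is about 2.30, too small for [lower_tail_le]; but [s^2 - s >= 3]
     forces [x >= 53 / 10]. *)
  have [m3'|m4] := leqP m 3.
    have -> : m = 3 by apply/eqP; rewrite eqn_leq m3' m3.
    apply: le_trans (pcdf4_le R); apply: pcdf_nincr; last lra.
    by rewrite xE; lra.
  have [t t1 mE] := sqr_subr_root m.
  have m4' : 4 <= m%:R :> R by rewrite ler_nat.
  (* The positive root of [t^2 - t = 4] is 2.561... *)
  have ht : 256 / 100 <= t by nra.
  have st : t <= s by nra.
  apply: le_trans (lower_tail_le ht mE).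
  by apply: pcdf_nincr; [rewrite xE; nra|rewrite sqr_ge0].
lra.
Qed.

Lemma le_of_or_le (a b c d : R) : a <= c -> a <= d -> c <= b \/ d <= b -> a <= b.
Proof. by move=> ac ad [cb|db]; [exact: le_trans cb|exact: le_trans db]. Qed.

Lemma within_sd_ge_inf x : 0 < x ->
  3 / 2 * expR (-1) <= fine (poissonP x (within_sd x)).
Proof.
move=> x0; have [s s0 xE] : exists2 s, 0 < s & x = s ^+ 2.
  by exists (Num.sqrt x); rewrite ?sqrtr_gt0// sqr_sqrtr// ltW.
have [x1|x1] := leP x 1.
  have s1 : s <= 1 by nra.
  (* The integer 1 enters the window at [x = 0.38...]; below [2 / 5] the atom at 0 alone
     suffices. *)
  have [x2|x2] := leP x (2 / 5).
    apply: le_trans (within_sd_ge (m := 0) (n := 0) s0 xE _ _ _) => //.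
    - rewrite pcdf0 subr0 pcdfS pcdf0 add0r /ppmf expr0 fact0 invr1 !mul1r.
      have := expR_ge1Dx (- x); have := expRN1_le R; lra.
    - by rewrite xE; nra.
    - by rewrite addr_ge0 ?ltW.
  apply: le_trans (within_sd_ge (m := 0) (n := 1) s0 xE _ _ _) => //.
  - rewrite pcdf0 subr0; apply: le_trans (pcdf_nincr 2 x1 (ltW x0)).
    by rewrite pcdf_horner /exp_horner; have := expR_ge0 (-1 : R); lra.
  - by rewrite xE; nra.
  - by rewrite xE; nra.
have s1 : 1 < s by nra.
(* The integer 3 enters at [x = 1.697...], just before [17 / 10]. *)
have [x2|x2] := leP x (17 / 10).
  apply: le_trans (within_sd_ge (m := 1) (n := 2) s0 xE _ _ _) => //; last 2 first.
  - by rewrite xE; nra.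
  - by rewrite xE; nra.
  have I : 1 <= x <= 17 / 10 by rewrite ltW.
  apply: le_of_or_le (@pcdf_window_min R 0 2 1 (17 / 10) x _ _ I) => //.
  (* At the left end [x = 1] the mass of 1 and 2 is exactly the claimed infimum. *)
  - by rewrite !pcdf_horner /exp_horner; have := expR_ge0 (-1 : R); lra.
  - exact: le_trans (expRN1_le R) (window13 R).
apply: le_trans (expRN1_le R) _.
(* The integer 1 leaves at the irrational value [x = 2.618...], so the rational ranges on its two
   sides overlap between [13 / 5] and [21 / 8]. *)
have [c1|c1] := leP (s ^+ 2 - s) 1.
  apply: le_trans (within_sd_ge (m := 1) (n := 3) s0 xE _ _ _) => //; last 2 first.
  - by rewrite xE; nra.
  - by rewrite xE; nra.
  have I : 17 / 10 <= x <= 21 / 8 by apply/andP; split; [exact: ltW|rewrite xE; nra].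
  have a0 : 0 < 17 / 10 :> R by lra.
  exact: (le_of_or_le (window14a R) (window14b R)
    (pcdf_window_min (isT : (0 <= 3)%N) a0 I)).
(* The integer 5 enters at [x = 3.208...], and 2 leaves after [x = 4]. *)
have [x3|x3] := leP x (10 / 3).
  apply: le_trans (within_sd_ge (m := 2) (n := 4) s0 xE _ _ _) => //; last 2 first.
  - by rewrite xE; nra.
  - by rewrite xE; nra.
  have I : 13 / 5 <= x <= 10 / 3 by apply/andP; split => //; rewrite xE; nra.
  have a0 : 0 < 13 / 5 :> R by lra.
  exact: (le_of_or_le (window25a R) (window25b R)
    (pcdf_window_min (isT : (1 <= 4)%N) a0 I)).
have [x4|x4] := leP x 4.
  apply: le_trans (within_sd_ge (m := 2) (n := 5) s0 xE _ _ _) => //; last 2 first.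
  - by rewrite xE; nra.
  - by rewrite xE; nra.
  have I : 10 / 3 <= x <= 4 by rewrite ltW.
  have a0 : 0 < 10 / 3 :> R by lra.
  exact: (le_of_or_le (window26a R) (window26b R)
    (pcdf_window_min (isT : (1 <= 5)%N) a0 I)).
(* The integer 3 leaves after [x = 5.302...], which is below [16 / 3]. *)
have [c3|c3] := leP (s ^+ 2 - s) 3; last exact: (within_sd_ge_large s0 xE (ltW c3)).
apply: le_trans (within_sd_ge (m := 3) (n := 6) s0 xE _ _ _) => //; last 2 first.
- by rewrite xE; nra.
- by rewrite xE; nra.
have I : 4 <= x <= 16 / 3 by apply/andP; split; [exact: ltW|rewrite xE; nra].
have a0 : 0 < 4 :> R by lra.
exact: (le_of_or_le (window37a R) (window37b R)
  (pcdf_window_min (isT : (2 <= 6)%N) a0 I)).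
Qed.

(** Here [s < x] excludes 0 and [x + s < 3] excludes 3. The exact value gives the upper bound on the
    infimum as [x] tends to 1. *)
Lemma within_sd_right_of_1 x : 1 < x -> x <= 3 / 2 ->
  fine (poissonP x (within_sd x)) = (x + x ^+ 2 / 2) * expR (- x).
Proof.
move=> x1 x2; have x0 : 0 < x by lra.
have [s s0 xE] : exists2 s, 0 < s & x = s ^+ 2.
  by exists (Num.sqrt x); rewrite ?sqrtr_gt0// sqr_sqrtr// ltW.
have s1 : 1 < s by nra.
have -> : within_sd x = [set k | (1 <= k < 3)%N].
  apply/seteqP; split => k; rewrite /within_sd /= {2}xE sqrtr_sqr (ger0_norm (ltW s0)).
    rewrite ler_norml => /andP[k1 k2]; apply/andP; split.
      case: k k1 k2 => // k1 k2; exfalso; move: k1; rewrite xE; nra.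
    by rewrite -(ltr_nat R); nra.
  move=> /andP[k1 k3].
  have k1' : 1 <= k%:R :> R by rewrite (ler_nat _ 1).
  have k2' : k%:R <= 2 :> R by rewrite (ler_nat _ _ 2).
  by rewrite ler_norml; apply/andP; split; rewrite xE; nra.
have := @poissonP_window R x 1 3 x0 erefl => ->.
by rewrite /= !pcdf_horner /exp_horner; field.
Qed.

End Main.

Theorem theorem4p1 (R : realType) :
  inf [set fine (poissonP lam
          [set n | `|poissonN R n - fine ('E_(poissonP lam)[poissonN R])%E|
                   <= Num.sqrt (fine ('V_(poissonP lam)[poissonN R])%E)])
      | lam in [set lam : R | 0 < lam]]
  = 3 / 2 * expR (-1).
Proof.
have E (lam : R) : 0 < lam ->
    [set n | `|poissonN R n - fine ('E_(poissonP lam)[poissonN R])%E|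
             <= Num.sqrt (fine ('V_(poissonP lam)[poissonN R])%E)] = within_sd lam.
  by move=> l0; rewrite poisson_expectation// poisson_variance.
set S := [set _ | _ in _].
have lb : lbound S (3 / 2 * expR (-1)).
  by move=> _ [lam /= l0 <-]; rewrite E//; exact: within_sd_ge_inf.
apply/eqP; rewrite eq_le; apply/andP; split; last first.
  apply: lb_le_inf => //; eexists; exists 1 => //=.
(* At parameter 1 the window also contains 0, so the value is only approached from the right, at
   [1 + d]. *)
apply/ler_addgt0Pr => e e0.
(* [(1 + d) + (1 + d)^2 / 2] exceeds [3 / 2] by at most [3 d <= e], and [d <= 1 / 2] allows
   [within_sd_right_of_1]. *)
pose d := Num.min (e / 3) (1 / 2).
have d0 : 0 < d by rewrite lt_min; apply/andP; split; lra.
have de : d <= e / 3 by rewrite ge_min lexx.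
have d2 : d <= 1 / 2 by rewrite ge_min lexx orbT.
apply: (@le_trans _ _ ((1 + d + (1 + d) ^+ 2 / 2) * expR (- (1 + d)))).
  apply: ge_inf; first by exists (3 / 2 * expR (-1)).
  exists (1 + d) => /=; first lra.
  by rewrite E ?within_sd_right_of_1//; lra.
have h1 : expR (- (1 + d)) <= expR (-1) by rewrite ler_expR; lra.
have h2 : expR (-1) <= 1 :> R by rewrite expR_le1; lra.
have h3 := expR_ge0 (-1 : R).
have h4 : 0 <= 1 + d + (1 + d) ^+ 2 / 2 by nra.
have := ler_wpM2l h4 h1; nra.
Qed.
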